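(* There exist absolute constants $C>0$ and $\eta\in(0,1)$ such that the following holds. Let $\mathcal{D}=\mathcal{D}_1\times\mathcal{D}_2$ be an arbitrary system of dyadic rectangles in $\mathbb{R}^2$, let $i=(i_1,i_2)$, $j=(j_1,j_2)$ be pairs of non-negative integers, let $T^{i,j}$ be a cancellative bi-parameter dyadic shift of complexity $(i,j)$ defined using rectangles from $\mathcal{D}$, and let $f,g$ be test functions (functions on $\mathbb{R}^2$ with finitely many nonzero Haar coefficients relative to $\mathcal{D}$). Then there exists a sparse collection $\mathcal{S}$ of $\mathcal{D}$-dyadic rectangles (with sparseness parameter $\eta$; the collection may depend on $f,g$ and $(i,j)$) such that $$|\langle T^{i,j}f,g\rangle|\le C\,2^{-(i_1+i_2+j_1+j_2)}\sum_{R\in\mathcal{S}}|R|\,(S^{i,j}f)_R\,(S^{j,i}g)_R .$$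
   Context: A dyadic grid in $\mathbb{R}$ is a collection of half-open intervals of lengths $2^{-k}$, $k\in\mathbb{Z}$, such that for each $k$ the intervals of length $2^{-k}$ partition $\mathbb{R}$ and each of them is the union of two intervals of the grid of length $2^{-k-1}$ (its left and right children). $\mathcal{D}=\mathcal{D}_1\times\mathcal{D}_2$ is the set of rectangles $R=R_1\times R_2$ with $R_1\in\mathcal{D}_1$, $R_2\in\mathcal{D}_2$, where $\mathcal{D}_1,\mathcal{D}_2$ are dyadic grids. For a dyadic interval $I$ and $k\in\{0,1,2,\dots\}$, $(I)_k$ is the set of dyadic intervals $J\subset I$ of the same grid with $|J|=2^{-k}|I|$. Haar functions: $h_I=|I|^{-1/2}(1_{I_l}-1_{I_r})$ with $I_l,I_r$ the left and right children of $I$, $h_R=h_{R_1}\otimes h_{R_2}$, and $\hat f(R)=\langle f,h_R\rangle$. A function with finitely many nonzero Haar coefficients is a finite linear combination of the $h_R$, $R\in\mathcal{D}$. A cancellative bi-parameter dyadic shift of complexity $(i,j)$ is an operator $$T^{i,j}f(y)=\sum_{\substack{R_1\in\mathcal{D}_1\\R_2\in\mathcal{D}_2}}\ \sum_{\substack{P_1\in(R_1)_{i_1}\\P_2\in(R_2)_{i_2}}}\ \sum_{\substack{Q_1\in(R_1)_{j_1}\\Q_2\in(R_2)_{j_2}}}a_{PQR}\,\hat f(P)\,h_Q(y),$$ where $P=P_1\times P_2$, $Q=Q_1\times Q_2$, $R=R_1\times R_2$ and the constants $a_{PQR}$ satisfy $$|a_{PQR}|\le\frac{\sqrt{|P_1||Q_1|}\sqrt{|P_2||Q_2|}}{|R_1||R_2|}=2^{-\frac12(i_1+j_1+i_2+j_2)}.$$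 The dyadic shifted square function is $$(S^{i,j}f(y))^2=\sum_{\substack{R_1\in\mathcal{D}_1\\R_2\in\mathcal{D}_2}}\Big(\sum_{\substack{P_1\in(R_1)_{i_1}\\P_2\in(R_2)_{i_2}}}|\hat f(P)|\Big)^2\Big(\sum_{\substack{Q_1\in(R_1)_{j_1}\\Q_2\in(R_2)_{j_2}}}\frac{1_{Q_1}}{|Q_1|}\otimes\frac{1_{Q_2}}{|Q_2|}(y)\Big),$$ and $S^{j,i}$ is the same with the roles of $i$ and $j$ exchanged. $(F)_R=\frac1{|R|}\int_RF$. A collection $\mathcal{S}$ of rectangles is sparse (in the disjoint-pieces sense) with parameter $\eta>0$ if for every $R\in\mathcal{S}$ there is $E_R\subset R$ with $|E_R|>\eta|R|$, and $E_R\cap E_{R'}=\emptyset$ whenever $R\ne R'$. *)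

(* Defs.v *)
From mathcomp Require Import all_boot all_order all_algebra.
From mathcomp Require Import all_classical all_reals all_analysis.
Set Implicit Arguments.
Unset Strict Implicit.
Unset Printing Implicit Defensive.
Import Order.TTheory GRing.Theory Num.Theory.
Local Open Scope classical_set_scope.
Local Open Scope ring_scope.

(* [(k, x)] encodes the half-open interval [x, x + 2^-k[. *)
Definition dyint (R : realType) : Type := (int * R)%type.

Section intervals.
Context {R : realType}.
Implicit Types (I J : dyint R) (D : set (dyint R)).

Definition ilen I : R := 2 ^ (- I.1).

Definition iset I : set R := `[I.2, I.2 + ilen I[.

Definition lchild I : dyint R := (I.1 + 1, I.2).
Definition rchild I : dyint R := (I.1 + 1, I.2 + ilen I / 2).

(* The two intervals J1, J2 of length |I|/2 with union I are necessarily
   [lchild I] and [rchild I]. *)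
Definition dyadic_grid D : Prop :=
  (forall k : int, classical_sets.partition [set I | D I /\ I.1 = k] iset [set: R]) /\
  (forall I, D I -> exists J1 J2,
    [/\ D J1, D J2, J1.1 = I.1 + 1, J2.1 = I.1 + 1 & iset I = iset J1 `|` iset J2]).

Definition idesc D I (k : nat) : set (dyint R) :=
  [set J | [/\ D J, iset J `<=` iset I & ilen J = 2 ^- k * ilen I]].

Definition ihaar I (x : R) : R :=
  (Num.sqrt (ilen I))^-1 * (\1_(iset (lchild I)) x - \1_(iset (rchild I)) x).

End intervals.

Definition dyrect (R : realType) : Type := (dyint R * dyint R)%type.

Section rectangles.
Context {R : realType}.
Implicit Types (r p q : dyrect R) (D : set (dyint R)) (i j : nat * nat).
Implicit Types (f g : R * R -> R) (y : R * R).

Definition leb2 := (@lebesgue_measure R \x @lebesgue_measure R)%E.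

Definition area r : R := ilen r.1 * ilen r.2.

Definition rset r : set (R * R) := iset r.1 `*` iset r.2.

Definition rdesc D1 D2 r i : set (dyrect R) :=
  idesc D1 r.1 i.1 `*` idesc D2 r.2 i.2.

Definition haar r y : R := ihaar r.1 y.1 * ihaar r.2 y.2.

Definition pairing f g : R := \int[leb2]_y (f y * g y).

Definition haar_coeff f r : R := pairing f (haar r).

Definition test_function D1 D2 f : Prop :=
  exists (A : set (dyrect R)) (c : dyrect R -> R),
    [/\ finite_set A, A `<=` D1 `*` D2 &
        forall y, f y = \sum_(r \in A) c r * haar r y].

Definition shift_coeffs D1 D2 i j (a : dyrect R -> dyrect R -> dyrect R -> R) :=
  forall r p q, (D1 `*` D2) r -> rdesc D1 D2 r i p -> rdesc D1 D2 r j q ->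
    `|a p q r| <= Num.sqrt (ilen p.1 * ilen q.1) * Num.sqrt (ilen p.2 * ilen q.2)
                  / (ilen r.1 * ilen r.2).

(* [\sum_(_ \in _)] is 0 when infinitely many terms are nonzero. This does not
   happen if f is a test function: the inner sum vanishes unless
   [haar_coeff f p != 0] for some p, and each p has a single (i.1, i.2)-th
   ancestor r. *)
Definition dyadic_shift D1 D2 i j (a : dyrect R -> dyrect R -> dyrect R -> R) f y : R :=
  \sum_(r \in D1 `*` D2)
    \sum_(p \in rdesc D1 D2 r i) \sum_(q \in rdesc D1 D2 r j)
      a p q r * haar_coeff f p * haar q y.

Definition shifted_square D1 D2 i j f y : \bar R :=
  sqrte (\esum_(r in D1 `*` D2)
    ((\sum_(p \in rdesc D1 D2 r i) `|haar_coeff f p|) ^+ 2 *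
     (\sum_(q \in rdesc D1 D2 r j)
        (\1_(iset q.1) y.1 / ilen q.1) * (\1_(iset q.2) y.2 / ilen q.2)))%:E).

Definition average (F : R * R -> \bar R) r : \bar R :=
  ((area r)^-1%:E * \int[leb2]_(y in rset r) F y)%E.

Definition sparse (eta : R) (S : set (dyrect R)) : Prop :=
  exists E : dyrect R -> set (R * R),
    (forall r, S r -> [/\ measurable (E r), E r `<=` rset r &
                          ((eta * area r)%:E < leb2 (E r))%E]) /\
    trivIset S E.

End rectangles.

(* Main.v *)
Require Import Defs.
From mathcomp Require Import all_boot all_order all_algebra.
From mathcomp Require Import all_classical all_reals all_analysis.
From mathcomp Require Import measurable_realfun.
From mathcomp Require Import ring lra.
Set Implicit Arguments.
Unset Strict Implicit.
Unset Printing Implicit Defensive.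
Import Order.TTheory GRing.Theory Num.Theory numFieldNormedType.Exports.
Local Open Scope classical_set_scope.
Local Open Scope ring_scope.

(* Put F_r = sum_(p in (r)_i) |f^(p)| and G_r = sum_(q in (r)_j) |g^(q)|. Up to the
   powers of 2 in the statement, the pairing is at most sum_r F_r G_r, and the two
   square functions are u = (sum_r F_r^2 1_r / |r|)^(1/2) and the analogous v built
   from G, so that sum_r F_r G_r 1_r / |r| <= u v by Cauchy-Schwarz. Give the
   rectangle r the weight lam_r = 64 (u)_r (v)_r and scan the finitely many relevant
   rectangles by decreasing weight, selecting r when more than half of it is not
   covered by the rectangles selected before. The uncovered parts are disjoint, so
   the selected family S is sparse. By Chebyshev, in every r a set of measure at
   least |r|/4 is both covered by selected rectangles of weight >= lam_r and
   contained in {u < 8 (u)_r} and {v < 8 (v)_r}, where u v <= lam_r. Restricting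
   sum_r F_r G_r 1_r / |r| to these sets makes it pointwise at most
   sum_(r in S) lam_r 1_r; integrating gives the bound. *)

(** * Sparse domination of products of square functions *)

(** Induction on the list sorted by increasing weight, so the head, of least weight, is treated
    after the tail. Either more than half of [A r] is still uncovered, and that uncovered part
    becomes [E r], or at least half of [A r] lies in sets already selected, all of weight at least
    [lam r]. The sets may overlap arbitrarily, which is what makes the argument fit rectangles, for
    which intersection does not imply nesting. *)
Lemma greedy_sparse (d : measure_display) (T : measurableType d) (R : realType)
    (mu : {measure set T -> \bar R}) (I : choiceType)
    (A : I -> set T) (m lam : I -> R) (s : seq I) :
  (forall r, measurable (A r)) -> (forall r, 0 < m r) ->
  (forall r, mu (A r) = (m r)%:E) ->
  exists (S : seq I) (E : I -> set T),
    [/\ uniq S, {subset S <= s},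
        (forall r, r \in S -> [/\ measurable (E r), E r `<=` A r &
           ((2^-1 * m r)%:E < mu (E r))%E]),
        trivIset [set` S] E &
        forall r, r \in s -> ((2^-1 * m r)%:E <=
          mu (A r `&` \big[setU/set0]_(t <- S | (lam r <= lam t)%R) A t))%E].
Proof.
move=> mA m0 muA.
pose le r t := lam r <= lam t.
have : sorted le (sort le s) by apply: sort_sorted => x y; exact: le_total.
have le_trans' : transitive le by move=> x y z; exact: le_trans.
have memE := mem_sort le s.
move: (sort le s) memE => s' memE srt.
suff [S [E [uS sS hE tE cov]]] : exists (S : seq I) (E : I -> set T),
    [/\ uniq S, {subset S <= s'},
        (forall r, r \in S -> [/\ measurable (E r), E r `<=` A r &
           ((2^-1 * m r)%:E < mu (E r))%E]),
        trivIset [set` S] E &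
        forall r, r \in s' -> ((2^-1 * m r)%:E <=
          mu (A r `&` \big[setU/set0]_(t <- S | (lam r <= lam t)%R) A t))%E].
  exists S, E; split=> // r; first by move/sS; rewrite memE.
  by rewrite -memE; exact: cov.
elim: s' {s memE} srt => [|r s IH] /=.
  by move=> _; exists [::], (fun=> set0); split.
rewrite (path_sortedE le_trans') => /andP[/allP rle srt].
have [S [E [uS sS hE tE cov]]] := IH srt.
pose V := \big[setU/set0]_(t <- S) A t.
have mV : measurable V by apply: bigsetU_measurable.
have VP x : V x <-> exists2 t, t \in S & A t x.
  by rewrite /V -bigcup_seq; split=> -[t]; exists t.
have [big|small] := boolP ((2^-1 * m r)%:E < mu (A r `\` V))%E.
(* A repeated entry would have empty uncovered part, so it is never selected twice. *)
- have rS : r \notin S.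
    apply/negP => rS; move: big; rewrite (_ : A r `\` V = set0).
      by rewrite measure0 lte_fin ltNge mulr_ge0// ?invr_ge0// ltW.
    by rewrite -subset0 => x [Ax]; apply; apply/VP; exists r.
  exists (r :: S), (fun t => if t == r then A r `\` V else E t); split.
  + by rewrite /= rS.
  + move=> t; rewrite !inE => /orP[/eqP->|/sS ->]; rewrite ?eqxx ?orbT//.
  + move=> t; rewrite inE; case: eqP => [-> _|_ /=]; last exact: hE.
    by split=> //; exact: measurableD.
  + have aux t : t \in S -> E t `&` (A r `\` V) = set0.
      move=> tS; have [_ EA _] := hE _ tS.
      by rewrite -subset0 => x [/EA Ax [_]]; apply; apply/VP; exists t.
    move=> t t' /=; rewrite !inE.
    case: (t =P r) => [->|tr] /=; case: (t' =P r) => [->|tr'] //= tS tS'.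
    * by rewrite setIC aux// => -[].
    * by rewrite aux// => -[].
    * exact: tE.
  + move=> t; rewrite inE => /orP[/eqP ->|ts].
      rewrite big_cons lexx setIUr setIid setUidl ?muA; last by move=> x [].
      by rewrite lee_fin; have := m0 r; lra.
    apply: le_trans (cov _ ts) _; apply: le_measure; rewrite ?inE.
    * by apply: measurableI => //; exact: bigsetU_measurable.
    * by apply: measurableI => //; exact: bigsetU_measurable.
    * apply: setIS; rewrite big_cons; by case: ifP => _ x Vx //; right.
- exists S, E; split=> //; first by move=> t /sS; rewrite inE => ->; rewrite orbT.
  move=> t; rewrite inE => /orP[/eqP ->|]; last exact: cov.
  (* As the head of the increasing list, [r] has weight at most that of every selected set, so the
     weight condition removes nothing from the union. *)
  rewrite (_ : \big[setU/set0]_(t <- S | _) A t = V); last first.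
    rewrite /V big_seq_cond [RHS]big_seq; apply: eq_bigl => u.
    by case: (boolP (u \in S)) => //= /sS /rle.
  have DE : mu (A r `\` V) = ((m r)%:E - mu (A r `&` V))%E.
    by rewrite -muA; apply: measureD => //; rewrite [X in (X < _)%E]muA ltry.
  move: small; rewrite -leNgt DE.
  have : (mu (A r `&` V) <= (m r)%:E)%E.
    by rewrite -muA; apply: le_measure; rewrite ?inE//; exact: measurableI.
  have := measure_ge0 mu (A r `&` V).
  move: (mu (A r `&` V)) => [x| |]//.
  rewrite -EFinB !lee_fin => _ _; lra.
Qed.

(** Chebyshev's inequality for a function of average [U] on a set of measure [m]. With the threshold
    8, two such exceptional sets take at most [m / 4], half of what the greedy selection guarantees
    to be covered. *)
Lemma chebyshev_average (d : measure_display) (T : measurableType d) (R : realType)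
    (mu : {measure set T -> \bar R}) (A : set T) (u : T -> R) (m U : R) :
  measurable A -> measurable_fun setT u -> (forall x, 0 <= u x) ->
  0 < U -> (\int[mu]_(x in A) (u x)%:E)%E = (m * U)%:E ->
  measurable (A `&` [set x | 8 * U <= u x]) /\
  (mu (A `&` [set x | (8 * U <= u x)%R]) <= (m / 8)%:E)%E.
Proof.
move=> mA mu_ u0 U0 intU; split.
  rewrite (_ : [set x | 8 * U <= u x] = u @^-1` `[8 * U, +oo[).
    by apply: measurable_funTS.
  by apply/seteqP; split=> x /=; rewrite in_itv/= andbT.
have mE : measurable_fun A (EFin \o u).
  by apply/measurable_EFinP; exact: measurable_funTS.
have U80 : 0 < 8 * U by lra.
have h : ((8 * U)%:E * mu (A `&` [set x | (8 * U <= u x)%R]) <= (m * U)%:E)%E.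
  rewrite -intU (_ : [set x | _] = [set x | ((8 * U)%:E <= `|(u x)%:E|)%E]).
    apply: le_trans (le_integral_abse mu mA mE U80) _.
    by under eq_integral do rewrite /= ger0_norm//.
  by apply/seteqP; split=> x /=; rewrite lee_fin ger0_norm.
have h0 : (0 <= mu (A `&` [set x | (8 * U <= u x)%R]))%E by exact: measure_ge0.
move: (mu _) h h0 => [x| |]//; last by rewrite gt0_muley ?lte_fin.
by rewrite -EFinM !lee_fin => h _; nra.
Qed.

Lemma sparse_domination (d : measure_display) (T : measurableType d) (R : realType)
    (mu : {measure set T -> \bar R}) (I : choiceType)
    (A : I -> set T) (m L U V : I -> R) (u v : T -> R) (s : seq I) :
  (forall r, measurable (A r)) -> (forall r, 0 < m r) ->
  (forall r, mu (A r) = (m r)%:E) ->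
  measurable_fun setT u -> measurable_fun setT v ->
  (forall x, 0 <= u x) -> (forall x, 0 <= v x) ->
  (forall r, 0 <= L r) ->
  (forall r, r \in s -> 0 < U r) -> (forall r, r \in s -> 0 < V r) ->
  (forall r, \int[mu]_(x in A r) (u x)%:E = (m r * U r)%:E)%E ->
  (forall r, \int[mu]_(x in A r) (v x)%:E = (m r * V r)%:E)%E ->
  (forall x, \sum_(r <- s) L r * \1_(A r) x <= u x * v x) ->
  exists (S : seq I) (E : I -> set T),
    [/\ uniq S, {subset S <= s},
        (forall r, r \in S -> [/\ measurable (E r), E r `<=` A r &
           ((2^-1 * m r)%:E < mu (E r))%E]),
        trivIset [set` S] E &
        \sum_(r <- s) L r * m r <= 256 * \sum_(r <- S) m r * U r * V r].
Proof.
move=> mA m0 muA mu_ mv u0 v0 L0 U0 V0 intU intV luv.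
(* Off [8 * U r <= u] and [8 * V r <= v], each at most 1/8 of [A r], the sum
   [\sum_r L r * \1_(A r) <= u * v] is at most [lam r]. *)
pose lam r := 64 * U r * V r.
have [S [E [uS sS hE tE cov]]] := greedy_sparse lam s mA m0 muA.
exists S, E; split=> //.
pose W r := \big[setU/set0]_(t <- S | lam r <= lam t) A t.
have mW r : measurable (W r) by exact: bigsetU_measurable.
pose Bu r := A r `&` [set x | 8 * U r <= u x].
pose Bv r := A r `&` [set x | 8 * V r <= v x].
have hBu r : r \in s -> measurable (Bu r) /\ (mu (Bu r) <= (m r / 8)%:E)%E.
  by move=> rs; apply: chebyshev_average => //; exact: U0.
have hBv r : r \in s -> measurable (Bv r) /\ (mu (Bv r) <= (m r / 8)%:E)%E.
  by move=> rs; apply: chebyshev_average => //; exact: V0.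
pose G r := (A r `&` W r) `\` (Bu r `|` Bv r).
have mG r : r \in s -> measurable (G r).
  by move=> rs; apply: measurableD; [exact: measurableI|
    apply: measurableU; [exact: (hBu r rs).1 | exact: (hBv r rs).1]].
(* At least half of [A r] is covered by [W r], and at most 1/4 is removed. *)
have hG r : r \in s -> ((m r / 4)%:E <= mu (G r))%E.
  move=> rs; have [mBu bu] := hBu r rs; have [mBv bv] := hBv r rs.
  have mBB := measurableU _ _ mBu mBv.
  have h1 : (mu (A r `&` W r) <= mu (G r) + mu (Bu r `|` Bv r))%E.
    apply: le_trans (measureU2 mu (mG _ rs) mBB); apply: le_measure; rewrite ?inE.
    - exact: measurableI.
    - by apply: measurableU => //; exact: mG.
    - by move=> x Ax; have [Bx|Bx] := pselect ((Bu r `|` Bv r) x); [right|left].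
  have h2 := measureU2 mu mBu mBv.
  have h3 : ((2^-1 * m r)%:E <= mu (G r) + ((m r / 8)%:E + (m r / 8)%:E))%E.
    apply: le_trans (cov r rs) _; apply: le_trans h1 _; apply: leeD2l.
    by apply: le_trans h2 _; exact: leeD.
  have h0 : (0 <= mu (G r))%E by exact: measure_ge0.
  move: (mu (G r)) h3 h0 => [x| |]//; last by move=> _ _; exact: leey.
  by rewrite -!EFinD !lee_fin; lra.
have sumG x : \sum_(r <- s) L r * \1_(G r) x <= \sum_(t <- S) lam t * \1_(A t) x.
  have lam0 t : t \in S -> 0 <= lam t.
    by move=> /sS ts; rewrite !mulr_ge0// ltW//; [exact: U0|exact: V0].
  have [[r rs Gx]|nG] := pselect (exists2 r0, r0 \in s & G r0 x); last first.
    rewrite [X in X <= _]big_seq big1 => [|r1 rs].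
      rewrite big_seq; apply: sumr_ge0 => t tS.
      by rewrite mulr_ge0// lam0.
    rewrite indicE memNset ?mulr0//; by move=> Gx; apply: nG; exists r1.
  have [[Ax Wx] nB] := Gx.
  have ux : u x < 8 * U r.
    by rewrite ltNge; apply/negP => ux; apply: nB; left.
  have vx : v x < 8 * V r.
    by rewrite ltNge; apply/negP => vx; apply: nB; right.
  (* Since [x] lies in [W r], some selected [t] of weight at least [lam r] contains it, and this
     single term of the right-hand sum already suffices. *)
  have [t tS [lamrt At]] : exists2 t, t \in S & lam r <= lam t /\ A t x.
    move: Wx; rewrite /W -bigcup_seq_cond => -[t /= /andP[tS lt] At].
    by exists t.
  apply: (@le_trans _ _ (lam t)); last first.
    rewrite (big_rem t)//= indicE mem_set// mulr1 lerDl big_seq.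
    apply: sumr_ge0 => t' /mem_rem tS'.
    by rewrite mulr_ge0// lam0.
  apply: le_trans lamrt; apply: (@le_trans _ _ (u x * v x)); last first.
    by rewrite /lam; have := u0 x; have := v0 x; nra.
  apply: le_trans (luv x); apply: ler_sum => r' _; apply: ler_wpM2l => //.
  rewrite !indicE ler_nat; case: (boolP (x \in G r')) => //; rewrite inE => -[[]].
  by move=> Ax' _ _; rewrite mem_set.
have intL (B : I -> set T) (c : I -> R) (l : seq I) :
    (forall r, r \in l -> measurable (B r)) -> (forall r, r \in l -> 0 <= c r) ->
  (\int[mu]_x (\sum_(r <- l) c r * \1_(B r) x)%:E =
   \sum_(r <- l) (c r)%:E * mu (B r))%E.
  move=> mB c0.
  (* Exchanging sum and integral asks for measurability and nonnegativity at every index, but they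
     are known only on [l]; the terms are therefore set to 0 elsewhere. *)
  pose h r x := if r \in l then (c r * \1_(B r) x)%:E else 0%E.
  transitivity (\int[mu]_x \sum_(r <- l) h r x)%E.
    apply: eq_integral => x _; rewrite -sumEFin big_seq [RHS]big_seq.
    by apply: eq_bigr => r rl; rewrite /h rl.
  rewrite ge0_integral_sum//.
  - rewrite big_seq [RHS]big_seq; apply: eq_bigr => r rl.
    under eq_integral do rewrite /h rl EFinM.
    rewrite ge0_integralZl_EFin ?c0//.
    + by rewrite integral_indic ?setIT//; exact: mB.
    + by apply/measurable_EFinP; apply: measurable_indic; exact: mB.
  - move=> r; rewrite /h; have [rl|rl] := boolP (r \in l); last exact: measurable_cst.
    apply/measurable_EFinP; apply: measurable_funM => //.
    by apply: measurable_indic; exact: mB.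
  - by move=> r x _; rewrite /h; case: ifP => // rl; rewrite lee_fin mulr_ge0 ?c0.
have lam0 t : t \in S -> 0 <= lam t.
  by move=> /sS ts; rewrite !mulr_ge0// ltW//; [exact: U0|exact: V0].
have mS (B : I -> set T) (c : I -> R) (l : seq I) :
    (forall r, r \in l -> measurable (B r)) ->
    measurable_fun setT (EFin \o (fun x => \sum_(r <- l) c r * \1_(B r) x)).
  move=> mB; apply/measurable_EFinP.
  rewrite (_ : (fun x => _) = (fun x => \sum_(r <- l)
      (if r \in l then c r * \1_(B r) x else 0))); last first.
    apply/funext => x; rewrite big_seq [RHS]big_seq.
    by apply: eq_bigr => r ->.
  apply: measurable_sum => r; have [rl|rl] := boolP (r \in l); last exact: measurable_cst.
  apply: measurable_funM => //.
  by apply: measurable_indic; exact: mB.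
have: (\sum_(r <- s) (L r)%:E * mu (G r) <= \sum_(t <- S) (lam t)%:E * mu (A t))%E.
  rewrite -!intL//; apply: ge0_le_integral => //.
  - by move=> x _; rewrite lee_fin sumr_ge0// => r _; rewrite mulr_ge0.
  - exact: mS.
  - exact: mS.
  - by move=> x _; rewrite lee_fin.
under [X in (_ <= X)%E -> _]eq_bigr do rewrite muA -EFinM.
rewrite sumEFin => h.
have : (\sum_(r <- s) (L r)%:E * (m r / 4)%:E <= (\sum_(t <- S) lam t * m t)%:E)%E.
  apply: le_trans h; rewrite big_seq [X in (_ <= X)%E]big_seq.
  apply: lee_sum => r rs; apply: lee_wpmul2l; first by rewrite lee_fin.
  exact: hG.
under eq_bigr do rewrite -EFinM.
rewrite sumEFin lee_fin => h'.
(* 256 = 4 * 64: the 64 is the factor in [lam], and the 4 pays for the lower bound [m r / 4] on the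
   measure of [G r]. *)
rewrite (_ : 256 * _ = 4 * \sum_(t <- S) lam t * m t); last first.
  rewrite !big_distrr/=; apply: eq_bigr => t _; rewrite /lam; ring.
rewrite (_ : \sum_(r <- s) L r * m r = 4 * \sum_(r <- s) L r * (m r / 4)).
  by rewrite ler_wpM2l.
rewrite big_distrr/=; apply: eq_bigr => r _; by field.
Qed.

(** By induction on the list; the step rests on the identity (x^2 + p^2)(y^2 + q^2) - (xy + pq)^2 =
    (xq - yp)^2, where p and q are the square roots of the two remaining sums. *)
Lemma cauchy_schwarz_seq (R : realType) (I : Type) (s : seq I) (x y : I -> R) :
  (forall k, 0 <= x k) -> (forall k, 0 <= y k) ->
  \sum_(k <- s) x k * y k <=
    Num.sqrt (\sum_(k <- s) x k ^+ 2) * Num.sqrt (\sum_(k <- s) y k ^+ 2).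
Proof.
move=> x0 y0; elim: s => [|k s IH]; first by rewrite !big_nil sqrtr0 mulr0.
rewrite !big_cons.
set X := \sum_(j <- s) x j ^+ 2 in IH *; set Y := \sum_(j <- s) y j ^+ 2 in IH *.
have X0 : 0 <= X by apply: sumr_ge0 => ? _; exact: sqr_ge0.
have Y0 : 0 <= Y by apply: sumr_ge0 => ? _; exact: sqr_ge0.
apply: (le_trans (lerD (lexx _) IH)); rewrite -[leRHS]sqrtrM; last first.
  by rewrite addr_ge0// sqr_ge0.
rewrite (le_trans (ler_norm _))// -sqrtr_sqr; apply: ler_wsqrtr.
rewrite -{2}(sqr_sqrtr X0) -{2}(sqr_sqrtr Y0) -subr_ge0.
set p := Num.sqrt X; set q := Num.sqrt Y.
rewrite (_ : _ - _ = (x k * q - y k * p) ^+ 2) ?sqr_ge0//; ring.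
Qed.

(** * Square functions over finite families of sets *)

Section SquareDomination.
Context (d : measure_display) (T : measurableType d) (R : realType).
Context (mu : {measure set T -> \bar R}).
Context (I : choiceType) (A : I -> set T) (m : I -> R) (s : seq I).
Context (mA : forall r, measurable (A r)) (m0 : forall r, 0 < m r).
Context (muA : forall r, mu (A r) = (m r)%:E).

(** A Haar square function with arbitrary numbers [F r] as coefficients: [\1_(A r) / m r] plays the
    role of the square of a Haar function. *)
Definition square_sum (F : I -> R) x := Num.sqrt (\sum_(r <- s) F r ^+ 2 / m r * \1_(A r) x).

Lemma measurable_square_sum F : measurable_fun setT (square_sum F).
Proof.
pose h x := \sum_(r <- s) F r ^+ 2 / m r * \1_(A r) x.
have msqrt := continuous_measurable_fun (@sqrt_continuous R).
have mh : measurable_fun setT h; last exact: measurableT_comp msqrt mh.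
apply: measurable_sum => r; exact: measurable_funM.
Qed.

Lemma square_sum_ge F r x : r \in s -> A r x -> Num.sqrt (F r ^+ 2 / m r) <= square_sum F x.
Proof.
move=> rs Ax; apply: ler_wsqrtr; rewrite (big_rem r)//= indicE mem_set// mulr1 lerDl.
by apply: sumr_ge0 => t _; rewrite mulr_ge0// divr_ge0 ?sqr_ge0// ltW.
Qed.

Lemma integrable_square_sum F r : mu.-integrable (A r) (EFin \o square_sum F).
Proof.
apply: measurable_bounded_integrable => //.
- by rewrite [X in (X < _)%E]muA ltry.
- by apply: measurable_funTS; exact: measurable_square_sum.
(* Replacing each indicator by 1 gives a bound independent of the point. *)
exists (Num.sqrt (\sum_(r <- s) F r ^+ 2 / m r)); split; first exact: num_real.
move=> M ltM x _ /=; rewrite ger0_norm ?sqrtr_ge0//; apply: le_trans (ltW ltM).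
apply: ler_wsqrtr; apply: ler_sum => t _.
rewrite ler_piMr ?divr_ge0 ?sqr_ge0 ?(ltW (m0 _))//.
Qed.

Definition square_average F r := (m r)^-1 * \int[mu]_(x in A r) square_sum F x.

Lemma square_averageE F r :
  (\int[mu]_(x in A r) (square_sum F x)%:E = (m r * square_average F r)%:E)%E.
Proof.
rewrite /square_average mulVKf ?gt_eqF// /Rintegral fineK//.
by apply: integrable_fin_num => //; exact: integrable_square_sum.
Qed.

(** On [A r] the square function is at least the square root of its own [r]-th term, a positive
    constant. Chebyshev's inequality needs this positivity. *)
Lemma square_average_gt0 F r : r \in s -> 0 < F r -> 0 < square_average F r.
Proof.
move=> rs F0; have := square_averageE F r.
have c0 : 0 < Num.sqrt (F r ^+ 2 / m r) by rewrite sqrtr_gt0 divr_gt0// exprn_gt0.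
suff : ((Num.sqrt (F r ^+ 2 / m r) * m r)%:E <= \int[mu]_(x in A r) (square_sum F x)%:E)%E.
  move=> /[swap] ->; rewrite lee_fin mulrC => /(lt_le_trans (mulr_gt0 (m0 r) c0)).
  by rewrite pmulr_rgt0.
rewrite EFinM -muA -integral_cst//; apply: ge0_le_integral => //.
- by move=> x _ /=; rewrite lee_fin ltW.
- by apply/measurable_EFinP; apply: measurable_funTS; exact: measurable_square_sum.
- by move=> x Ax; rewrite lee_fin; exact: square_sum_ge.
Qed.

Lemma sparse_square_domination (F G : I -> R) :
  (forall r, 0 <= F r) -> (forall r, 0 <= G r) ->
  exists (S : seq I) (E : I -> set T),
    [/\ uniq S, {subset S <= s},
        (forall r, r \in S -> [/\ measurable (E r), E r `<=` A r &
           ((2^-1 * m r)%:E < mu (E r))%E]),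
        trivIset [set` S] E &
        \sum_(r <- s) F r * G r <=
          256 * \sum_(r <- S) m r * square_average F r * square_average G r].
Proof.
move=> F0 G0.
(* Indices with zero product contribute nothing to the left-hand side, but their averages could
   vanish. They are dropped from the selection only; the square functions still run over all of
   [s]. *)
pose s' := [seq r <- s | F r * G r != 0].
pose L r := F r * G r / m r.
have s'P r : r \in s' -> [/\ r \in s, 0 < F r & 0 < G r].
  rewrite mem_filter mulf_eq0 negb_or => /andP[/andP[Fr Gr] rs].
  by rewrite !lt_neqAle ![0 == _]eq_sym Fr Gr F0 G0.
have [||||||||S [E [uS sS hE tE dom]]] := @sparse_domination _ _ _ mu _ A m L
  (square_average F) (square_average G) (square_sum F) (square_sum G) s' mA m0 muA
  (measurable_square_sum F) (measurable_square_sum G).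
- by move=> x; exact: sqrtr_ge0.
- by move=> x; exact: sqrtr_ge0.
- by move=> r; rewrite divr_ge0 ?mulr_ge0// ltW.
- by move=> r /s'P[rs Fr _]; exact: square_average_gt0.
- by move=> r /s'P[rs _ Gr]; exact: square_average_gt0.
- exact: square_averageE.
- exact: square_averageE.
- move=> x; rewrite /square_sum.
  (* [a F r] and [a G r] square to the terms of the two square functions, the indicator being
     idempotent, and their product is [L r * \1_(A r) x]. Cauchy-Schwarz then gives the pointwise
     hypothesis. *)
  pose a (H : I -> R) r := H r / Num.sqrt (m r) * \1_(A r) x.
  have aE H r : a H r ^+ 2 = H r ^+ 2 / m r * \1_(A r) x.
    rewrite /a !exprMn exprVn sqr_sqrtr ?(ltW (m0 r))//.
    by rewrite indicE; case: (_ \in _); rewrite ?expr1n ?expr0n.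
  have a0 H r : 0 <= H r -> 0 <= a H r.
    by move=> Hr; rewrite mulr_ge0 ?divr_ge0 ?sqrtr_ge0.
  under [X in _ <= Num.sqrt X * _]eq_bigr do rewrite -aE.
  under [X in _ <= _ * Num.sqrt X]eq_bigr do rewrite -aE.
  apply: le_trans (cauchy_schwarz_seq s (fun r => a0 F r (F0 r)) (fun r => a0 G r (G0 r))).
  rewrite big_filter big_mkcond/=; apply: ler_sum => r _.
  have -> : a F r * a G r = L r * \1_(A r) x.
    rewrite /a /L indicE; case: (_ \in _); rewrite ?mulr0// !mulr1 -[RHS]mulrA.
    have q0 : 0 < Num.sqrt (m r) by rewrite sqrtr_gt0.
    rewrite -[in RHS](sqr_sqrtr (ltW (m0 r))); field.
    by rewrite gt_eqF.
  by case: ifP => // _; rewrite mulr_ge0// divr_ge0 ?mulr_ge0// ltW.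
exists S, E; split=> //; first by move=> r /sS /s'P[].
apply: le_trans dom; rewrite big_filter [X in _ <= X]big_mkcond.
apply: ler_sum => r _; rewrite /L mulfVK; last by rewrite gt_eqF.
by case: (eqVneq (F r * G r) 0) => [->|].
Qed.

End SquareDomination.

(** * Dyadic grids *)

Section Grid.
Context {R : realType}.
Implicit Types (I J : dyint R) (D : set (dyint R)) (n : nat).

Lemma ilen_gt0 I : 0 < ilen I.
Proof. by rewrite /ilen exprz_gt0. Qed.

Lemma ilenD I J n : J.1 = I.1 + n%:Z -> ilen J = 2 ^- n * ilen I.
Proof.
move=> JI; rewrite /ilen JI opprD expfzDr ?pnatr_eq0// mulrC.
by rewrite exprnN.
Qed.

Lemma ilen_inj I J : ilen I = ilen J -> I.1 = J.1.
Proof.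
have two1 : (2 : R) != 1 by rewrite gt_eqF// ltr1n.
have two0 : 0 < (2 : R) by [].
by move=> /(ieexprIz two0 two1) /oppr_inj.
Qed.

Lemma ilen_eqD I J n : ilen J = 2 ^- n * ilen I -> J.1 = I.1 + n%:Z.
Proof. by rewrite -(@ilenD I (I.1 + n%:Z, 0) n)// => /ilen_inj. Qed.

Lemma ilen_lchild I : ilen (lchild I) = ilen I / 2.
Proof. by rewrite (@ilenD I _ 1)// expr1 mulrC. Qed.

Lemma ilen_rchild I : ilen (rchild I) = ilen I / 2.
Proof. by rewrite (@ilenD I _ 1)// expr1 mulrC. Qed.

Lemma isetP I x : iset I x <-> I.2 <= x < I.2 + ilen I.
Proof. by rewrite /iset /= in_itv. Qed.

Lemma iset_left I : iset I I.2.
Proof. by apply/isetP; rewrite lexx ltrDl ilen_gt0. Qed.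

Lemma iset_children I : iset I = iset (lchild I) `|` iset (rchild I).
Proof.
have := ilen_gt0 I => l0.
apply/seteqP; split=> x.
  move/isetP => /andP[h1 h2].
  have [h|h] := ltP x (I.2 + ilen I / 2); [left|right]; apply/isetP.
    by rewrite ilen_lchild /= h1 h.
  by rewrite ilen_rchild /= h /=; lra.
by move=> [] /isetP /=; rewrite ?ilen_lchild ?ilen_rchild => /andP[h1 h2];
  apply/isetP; apply/andP; split; lra.
Qed.

Lemma children_disjoint I x : iset (lchild I) x -> iset (rchild I) x -> False.
Proof.
move/isetP => /=; rewrite ilen_lchild => /andP[_ h] /isetP /= /andP[h' _]; lra.
Qed.

Section InGrid.
Context {D : set (dyint R)} (gD : dyadic_grid D).

Lemma grid_cover (k : int) (x : R) : exists2 I, D I & I.1 = k /\ iset I x.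
Proof.
have [[]] := gD.1 k; rewrite -subTset => /(_ x I)[I0 [DI Ik] Ix] _ _.
by exists I0.
Qed.

Lemma grid_uniq I J x : D I -> D J -> I.1 = J.1 -> iset I x -> iset J x -> I = J.
Proof.
move=> DI DJ IJ Ix Jx; have [_ /(_ I J) tI _] := gD.1 I.1.
by apply: tI => //; exists x.
Qed.

(** Of the two halves supplied by the grid, let [J1] contain the left endpoint of [I]; then it
    starts there. As [J1] is half-open, the midpoint must lie in [J2], so [J2] starts no later than
    it. If [J2] started earlier, its right endpoint would lie in [I] but in neither half. *)
Lemma grid_children I : D I -> D (lchild I) /\ D (rchild I).
Proof.
move=> DI; have [J1 [J2 [DJ1 DJ2 J1I J2I IJ]]] := gD.2 _ DI.
have l0 := ilen_gt0 I.
have len1 : ilen J1 = ilen I / 2 by rewrite (@ilenD I _ 1)// expr1 mulrC.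
have len2 : ilen J2 = ilen I / 2 by rewrite (@ilenD I _ 1)// expr1 mulrC.
wlog J1l : J1 J2 DJ1 DJ2 J1I J2I IJ len1 len2 / iset J1 I.2.
  move=> H; have := iset_left I; rewrite {1}IJ => -[h|h].
    exact: (H J1 J2).
  by apply: (H J2 J1) => //; rewrite setUC.
have sub1 : iset I J1.2 by rewrite IJ; left; exact: iset_left.
have sub2 : iset I J2.2 by rewrite IJ; right; exact: iset_left.
have JJ1 : J1.2 = I.2.
  move/isetP : J1l => /andP[h1 h2]; move/isetP : sub1 => /andP[h3 h4]; lra.
have mid : iset I (I.2 + ilen I / 2) by apply/isetP; apply/andP; split; lra.
have J2m : J2.2 <= I.2 + ilen I / 2.
  move: mid; rewrite IJ => -[] /isetP /andP[] //.
  by rewrite JJ1 len1 ltxx.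
have JJ2 : J2.2 = I.2 + ilen I / 2.
  apply/eqP; rewrite eq_le J2m /= leNgt; apply/negP => h.
  move/isetP : sub2 => /andP[h3 h4].
  have : iset I (J2.2 + ilen I / 2) by apply/isetP; apply/andP; split; lra.
  by rewrite IJ => -[] /isetP /andP[]; rewrite ?JJ1 ?len1 ?len2; lra.
split.
  by rewrite (_ : lchild I = J1)//; case: (J1) J1I JJ1 => a b /= -> ->.
by rewrite (_ : rchild I = J2)//; case: (J2) J2I JJ2 => a b /= -> ->.
Qed.

(** Descend from [I] to the child containing the common point [x]: it is again in the grid and one
    generation closer to [J]. When the generations agree, the partition property identifies the two
    intervals. *)
Lemma grid_nest n I J x : D I -> D J -> J.1 = I.1 + n%:Z ->
  iset I x -> iset J x -> iset J `<=` iset I.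
Proof.
elim: n I => [|n IH] I DI DJ JI Ix Jx.
  by rewrite (@grid_uniq I J x)// JI addr0.
have [Dl Dr] := grid_children DI.
have JI' : J.1 = I.1 + 1 + n%:Z by rewrite JI -addrA -intS.
move: Ix; rewrite iset_children => -[cx|cx].
  by apply: subset_trans (@subsetUl _ _ _); exact: (IH (lchild I)).
by apply: subset_trans (@subsetUr _ _ _); exact: (IH (rchild I)).
Qed.

Lemma idesc_cover n I x : D I -> iset I x -> exists2 J, idesc D I n J & iset J x.
Proof.
move=> DI Ix; have [J DJ [JI Jx]] := grid_cover (I.1 + n%:Z) x.
by exists J => //; split => //; [exact: (grid_nest DI DJ JI Ix Jx)|exact: ilenD].
Qed.

Lemma idesc_uniq n I J K x : idesc D I n J -> idesc D I n K ->
  iset J x -> iset K x -> J = K.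
Proof.
by move=> [DJ _ lJ] [DK _ lK]; apply: grid_uniq => //; apply: ilen_inj; rewrite lJ.
Qed.

(** A descendant of order [n.+1] is a descendant of order [n] of the child containing its left
    endpoint. *)
Lemma finite_idesc n I : D I -> finite_set (idesc D I n).
Proof.
elim: n I => [|n IH] I DI.
  apply: (@sub_finite_set _ _ [set I]) => // J [DJ JI].
  rewrite expr0 invr1 mul1r => /ilen_inj lJ.
  by apply: (@grid_uniq J I J.2) => //; [exact: iset_left|apply: JI; exact: iset_left].
have [Dl Dr] := grid_children DI.
apply: (@sub_finite_set _ _ (idesc D (lchild I) n `|` idesc D (rchild I) n)).
  move=> J [DJ JI /ilen_eqD lJ].
  have lJ' : J.1 = I.1 + 1 + n%:Z by rewrite lJ -addrA -intS.
  have : iset I J.2 by apply: JI; exact: iset_left.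
  rewrite iset_children => -[h|h]; [left|right]; split => //.
  - exact: (grid_nest Dl DJ lJ' h (iset_left J)).
  - exact: ilenD.
  - exact: (grid_nest Dr DJ lJ' h (iset_left J)).
  - exact: ilenD.
by rewrite finite_setU; split; exact: IH.
Qed.

(** Thanks to this uniqueness each Haar coefficient enters the inner sum of only one rectangle, so
    finitely many coefficients give finitely many nonzero sums. *)
Lemma idesc_ancestor n I I' J : D I -> D I' -> idesc D I n J -> idesc D I' n J ->
  I = I'.
Proof.
move=> DI DI' [DJ JI /ilen_eqD lJ] [_ JI' /ilen_eqD lJ'].
apply: (@grid_uniq I I' J.2) => //; last 2 first.
- by apply: JI; exact: iset_left.
- by apply: JI'; exact: iset_left.
by apply: (addIr n%:Z); rewrite -lJ.
Qed.

(** Inclusion in a child, rather than in the interval itself, is what makes the Haar function of the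
    larger interval constant on the smaller one. *)
Lemma grid_trichotomy I J : D I -> D J -> I != J ->
  [\/ iset I `&` iset J = set0,
      iset J `<=` iset (lchild I) \/ iset J `<=` iset (rchild I) |
      iset I `<=` iset (lchild J) \/ iset I `<=` iset (rchild J)].
Proof.
have aux I' J' x : D I' -> D J' -> I' != J' -> iset I' x -> iset J' x ->
    I'.1 <= J'.1 ->
    iset J' `<=` iset (lchild I') \/ iset J' `<=` iset (rchild I').
  move=> DI DJ IJ Ix Jx; rewrite -subr_ge0 => /gez0_abs.
  move: `|_|%N => [|n] nE.
    move/eqP : IJ; case; apply: (@grid_uniq I' J' x) => //.
    by apply/esym/eqP; rewrite -subr_eq0 -nE.
  have JE : J'.1 = I'.1 + 1 + n%:Z by rewrite -addrA -intS nE addrC subrK.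
  have [Dl Dr] := grid_children DI.
  move: Ix; rewrite iset_children => -[h|h]; [left|right].
    exact: (grid_nest Dl DJ JE h Jx).
  exact: (grid_nest Dr DJ JE h Jx).
move=> DI DJ IJ.
have [->|/set0P[x [Ix Jx]]] := eqVneq (iset I `&` iset J) set0; first by constructor 1.
have [le|/ltW le] := leP I.1 J.1; first by constructor 2; exact: (aux _ _ x).
by constructor 3; apply: (aux _ _ x) => //; rewrite eq_sym.
Qed.

End InGrid.
End Grid.

(** * Haar functions *)

Lemma integrable_indic_lty (d : measure_display) (T : measurableType d) (R : realType)
    (mu : {measure set T -> \bar R}) (A : set T) :
  measurable A -> (mu A < +oo)%E -> mu.-integrable setT (EFin \o \1_A).
Proof.
move=> mA Afin; apply/integrableP; split.
  by apply/measurable_EFinP; exact: measurable_indic.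
under eq_integral do rewrite /= ger0_norm//.
by rewrite integral_indic// setIT.
Qed.

Section Haar.
Context {R : realType}.
Implicit Types (I J : dyint R) (D : set (dyint R)).

Lemma measurable_iset I : measurable (iset I : set R).
Proof. exact: measurable_itv. Qed.

Lemma lebesgue_iset I : lebesgue_measure (iset I) = (ilen I)%:E.
Proof.
rewrite /iset lebesgue_measure_itv/= lte_fin ltrDl ilen_gt0 -EFinD.
by rewrite addrAC subrr add0r.
Qed.

Lemma measurable_rset (r : dyrect R) : measurable (rset r).
Proof. by apply: measurableX; exact: measurable_iset. Qed.

Lemma leb2_rset (r : dyrect R) : leb2 (rset r) = (area r)%:E.
Proof.
rewrite /leb2 product_measure1E; try exact: measurable_iset.
by rewrite [X in (X * _)%E]lebesgue_iset [X in (_ * X)%E]lebesgue_iset.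
Qed.

Lemma measurable_ihaar I : measurable_fun setT (ihaar I).
Proof.
apply: measurable_funM => //; apply: measurable_funB;
  by apply: measurable_indic; exact: measurable_iset.
Qed.

Lemma ihaar_out I x : ~ iset I x -> ihaar I x = 0.
Proof.
rewrite iset_children => nI; rewrite /ihaar !indicE !memNset ?subrr ?mulr0//.
- by move=> h; apply: nI; right.
- by move=> h; apply: nI; left.
Qed.

Lemma ihaar_left I x : iset (lchild I) x -> ihaar I x = (Num.sqrt (ilen I))^-1.
Proof.
move=> h; rewrite /ihaar !indicE mem_set// memNset ?subr0 ?mulr1//.
exact: children_disjoint.
Qed.

Lemma ihaar_right I x : iset (rchild I) x -> ihaar I x = - (Num.sqrt (ilen I))^-1.
Proof.
move=> h; rewrite /ihaar !indicE [x \in iset (rchild I)]mem_set// memNset ?sub0r ?mulrN1//.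
by move=> h'; exact: (children_disjoint h' h).
Qed.

Lemma ihaar_le I x : `|ihaar I x| <= (Num.sqrt (ilen I))^-1 * \1_(iset I) x.
Proof.
have [h|h] := pselect (iset I x); last first.
  by rewrite ihaar_out// normr0 mulr_ge0// invr_ge0 sqrtr_ge0.
rewrite indicE mem_set// mulr1; move: h; rewrite iset_children => -[h|h].
  by rewrite ihaar_left// ger0_norm// invr_ge0 sqrtr_ge0.
by rewrite ihaar_right// normrN ger0_norm// invr_ge0 sqrtr_ge0.
Qed.

Lemma integrable_indic_iset I :
  lebesgue_measure.-integrable setT (EFin \o \1_(iset I)).
Proof.
apply: integrable_indic_lty; first exact: measurable_iset.
by rewrite [X in (X < _)%E]lebesgue_iset ltry.
Qed.

Lemma ihaarE I x : (ihaar I x)%:E = ((Num.sqrt (ilen I))^-1%:E *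
  ((EFin \o \1_(iset (lchild I))) \- (EFin \o \1_(iset (rchild I)))) x)%E.
Proof. by rewrite /ihaar EFinM EFinB. Qed.

Lemma integrable_ihaar I : lebesgue_measure.-integrable setT (EFin \o ihaar I).
Proof.
rewrite (funext (ihaarE I) : EFin \o ihaar I = _).
by apply: integrableZl => //; apply: integrableB => //; exact: integrable_indic_iset.
Qed.

Lemma integral_ihaar (c : R) I : (\int[lebesgue_measure]_x (c * ihaar I x)%:E = 0)%E.
Proof.
under eq_integral do rewrite EFinM.
rewrite integralZl//; last exact: integrable_ihaar.
under eq_integral do rewrite ihaarE.
rewrite integralZl//; last first.
  by apply: integrableB => //; exact: integrable_indic_iset.
rewrite integralB//; try exact: integrable_indic_iset.
rewrite !integral_indic//; try exact: measurable_iset.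
by rewrite !setIT [X in (X - _)%E]lebesgue_iset [X in (_ - X)%E]lebesgue_iset
  ilen_lchild ilen_rchild subee// !mule0.
Qed.

(** The Haar function of the larger interval is constant on the smaller one, so the product is a
    multiple of the smaller Haar function; for disjoint intervals it is 0. Either way the product
    has integral zero. *)
Lemma ihaar_mul D I J : dyadic_grid D -> D I -> D J -> I != J ->
  exists (c : R) K, forall x, ihaar I x * ihaar J x = c * ihaar K x.
Proof.
have aux I' J' :
    iset J' `<=` iset (lchild I') \/ iset J' `<=` iset (rchild I') ->
    exists c : R, forall x, ihaar I' x * ihaar J' x = c * ihaar J' x.
  move=> [h|h].
    exists (Num.sqrt (ilen I'))^-1 => x; have [Jx|Jx] := pselect (iset J' x).
      by rewrite ihaar_left//; exact: h.
    by rewrite (ihaar_out Jx) !mulr0.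
  exists (- (Num.sqrt (ilen I'))^-1) => x; have [Jx|Jx] := pselect (iset J' x).
    by rewrite ihaar_right//; exact: h.
  by rewrite (ihaar_out Jx) !mulr0.
move=> gD DI DJ IJ; have [dis|h|h] := grid_trichotomy gD DI DJ IJ.
- exists 0, I => x; rewrite mul0r; have [Ix|Ix] := pselect (iset I x).
    rewrite (@ihaar_out J) ?mulr0// => Jx.
    by have : (iset I `&` iset J) x; [split|rewrite dis].
  by rewrite ihaar_out// mul0r.
- by have [c hc] := aux _ _ h; exists c, J.
- by have [c hc] := aux _ _ h; exists c, I => x; rewrite mulrC.
Qed.

Lemma measurable_haar (r : dyrect R) : measurable_fun setT (haar r).
Proof.
apply: measurable_funM.
  by apply: (measurableT_comp (measurable_ihaar r.1)); exact: measurable_fst.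
by apply: (measurableT_comp (measurable_ihaar r.2)); exact: measurable_snd.
Qed.

Lemma haar_le (r : dyrect R) y :
  `|haar r y| <= (Num.sqrt (ilen r.1))^-1 * (Num.sqrt (ilen r.2))^-1 * \1_(rset r) y.
Proof.
rewrite normrM (le_trans (ler_pM _ _ (ihaar_le _ _) (ihaar_le _ _)))//.
rewrite mulrACA ler_wpM2l// ?mulr_ge0 ?invr_ge0 ?sqrtr_ge0// !indicE -natrM ler_nat.
case: (boolP (y.1 \in _)) => //=; rewrite inE => h1.
case: (boolP (y.2 \in _)) => //=; rewrite inE => h2.
by rewrite mem_set.
Qed.

Lemma integrable_haarM (r p : dyrect R) :
  (@leb2 R).-integrable setT (fun y => (haar r y * haar p y)%:E).
Proof.
pose c (t : dyrect R) := (Num.sqrt (ilen t.1))^-1 * (Num.sqrt (ilen t.2))^-1.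
have c0 t : 0 <= c t by rewrite mulr_ge0// ?invr_ge0 ?sqrtr_ge0.
have H := @le_integrable _ _ R (@leb2 R) setT measurableT
  (fun y => (haar r y * haar p y)%:E) (fun y => (c r * c p)%:E * (\1_(rset p) y)%:E)%E.
apply: H.
- apply/measurable_EFinP; apply: measurable_funM; exact: measurable_haar.
- move=> y _ /=; rewrite lee_fin normrM [X in _ <= X]ger0_norm; last first.
    by rewrite mulr_ge0// mulr_ge0.
  rewrite -mulrA ler_pM//; last exact: haar_le.
  apply: le_trans (haar_le _ _) _; rewrite -[leRHS]mulr1 ler_wpM2l//.
- apply: integrableZl => //; apply: integrable_indic_lty.
    exact: measurable_rset.
  by rewrite [X in (X < _)%E]leb2_rset ltry.
Qed.

Lemma pairing_haarE (r p : dyrect R) :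
  (pairing (haar r) (haar p))%:E = (\int[leb2]_y (haar r y * haar p y)%:E)%E.
Proof.
rewrite /pairing /Rintegral fineK//; apply: integrable_fin_num => //.
exact: integrable_haarM.
Qed.

(** Distinct rectangles differ in some side. By Fubini the integral may be taken first in that
    variable, where the product of the two one-dimensional Haar functions has mean zero. *)
Lemma haar_orthogonal D1 D2 (r p : dyrect R) : dyadic_grid D1 -> dyadic_grid D2 ->
  (D1 `*` D2) r -> (D1 `*` D2) p -> r != p -> pairing (haar r) (haar p) = 0.
Proof.
move=> g1 g2 [r1 r2] [p1 p2] rp; apply: EFin_inj; rewrite pairing_haarE.
rewrite /leb2.
have [r1p1|r1p1] := eqVneq r.1 p.1.
  have r2p2 : r.2 != p.2.
    by apply: contra_neq rp; case: r p r1p1 {r1 r2 p1 p2} => [? ?] [? ?] /= -> ->.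
  have [c [K cK]] := ihaar_mul g2 r2 p2 r2p2.
  rewrite -integral12_prod_meas1; last exact: integrable_haarM.
  apply: integral0_eq => x _; rewrite /fubini_F.
  under eq_integral => y _ do
    rewrite /haar /= mulrACA cK mulrA.
  exact: integral_ihaar.
have [c [K cK]] := ihaar_mul g1 r1 p1 r1p1.
rewrite -integral21_prod_meas1; last exact: integrable_haarM.
apply: integral0_eq => y _; rewrite /fubini_G.
under eq_integral => x _ do
  rewrite /haar /= mulrACA cK mulrC mulrA.
exact: integral_ihaar.
Qed.
End Haar.

(** * Shifts and shifted square functions *)

Section Pairing.
Context {R : realType}.
Implicit Types (f g : R * R -> R) (D : set (dyint R)).

(** [pairing] is the finite part of an extended integral, so its linearity has to be guarded by
    integrability of the product. *)
Definition pairable f g : Prop := (@leb2 R).-integrable setT (fun y => (f y * g y)%:E).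

Lemma pairingC f g : pairing f g = pairing g f.
Proof. by apply: eq_Rintegral => y _; rewrite mulrC. Qed.

Lemma pairableC f g : pairable f g -> pairable g f.
Proof. by rewrite /pairable; under eq_fun do rewrite mulrC. Qed.

Lemma pairable_suml (I : Type) (s : seq I) (u : I -> R * R -> R) g :
  (forall k, pairable (u k) g) -> pairable (fun y => \sum_(k <- s) u k y) g.
Proof.
move=> ug; rewrite /pairable.
under eq_fun do rewrite mulr_suml -sumEFin.
have H := @integrable_sum _ _ R (@leb2 R) setT measurableT I s xpredT
  (fun k y => (u k y * g y)%:E).
by apply: H => k _; exact: ug.
Qed.

Lemma pairableZl c f g : pairable f g -> pairable (fun y => c * f y) g.
Proof.
move=> fg; rewrite /pairable; under eq_fun do rewrite -mulrA EFinM.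
have H := @integrableZl _ _ R (@leb2 R) setT measurableT c (fun y => (f y * g y)%:E).
exact: H.
Qed.

Lemma pairing_suml (I : Type) (s : seq I) (u : I -> R * R -> R) g :
  (forall k, pairable (u k) g) ->
  pairing (fun y => \sum_(k <- s) u k y) g = \sum_(k <- s) pairing (u k) g.
Proof.
move=> ug; rewrite /pairing /Rintegral.
under eq_integral do rewrite mulr_suml -sumEFin.
have H := @integral_sum _ _ R (@leb2 R) setT measurableT I
  (fun k y => (u k y * g y)%:E) ug s xpredT.
rewrite [X in fine X]H -sum_fine// => k _.
have F := @integrable_fin_num _ _ R (@leb2 R) setT measurableT
  (fun y => (u k y * g y)%:E) (ug k).
exact: F.
Qed.

Lemma pairingZl c f g : pairable f g ->
  pairing (fun y => c * f y) g = c * pairing f g.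
Proof.
move=> fg; rewrite /pairing.
under eq_Rintegral do rewrite -mulrA.
have H := @RintegralZl _ _ R (@leb2 R) setT (fun y => f y * g y) c measurableT fg.
exact: H.
Qed.

Context {D1 D2 : set (dyint R)}.

Lemma test_functionP f : test_function D1 D2 f ->
  exists (s : seq (dyrect R)) (c : dyrect R -> R),
    (forall r, r \in s -> (D1 `*` D2) r) /\
    f = (fun y => \sum_(r <- s) c r * haar r y).
Proof.
move=> [A [c [fA AD fE]]]; exists (finmap.enum_fset (fset_set A)), c; split.
  by move=> r; rewrite in_fset_set// inE => /AD.
by apply/funext => y; rewrite fE fsbig_finite.
Qed.

Lemma pairable_haar f p : test_function D1 D2 f -> pairable (haar p) f.
Proof.
move=> /test_functionP[s [c [_ ->]]]; apply/pairableC.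
by apply: pairable_suml => k; apply: pairableZl; exact: integrable_haarM.
Qed.

(** By orthogonality only rectangles listed in the expansion of [f] can carry a nonzero
    coefficient. *)
Lemma finite_haar_support f : dyadic_grid D1 -> dyadic_grid D2 ->
  test_function D1 D2 f ->
  finite_set [set p | (D1 `*` D2) p /\ haar_coeff f p != 0].
Proof.
move=> g1 g2 /test_functionP[s [c [sD ->]]].
apply: (@sub_finite_set _ _ [set` s]) => [p [Dp]|]; last exact: finite_seq.
apply: contraNT => ps; apply/eqP.
rewrite /haar_coeff pairing_suml; last first.
  by move=> k; apply: pairableZl; exact: integrable_haarM.
rewrite big_seq big1// => r rs; rewrite pairingZl ?(haar_orthogonal g1 g2) ?mulr0//.
- exact: sD.
- by apply: contraNneq ps => <-.
- exact: integrable_haarM.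
Qed.

End Pairing.

(** With [i] and [f] these are the numbers F_r of the plan, with [j] and [g] the numbers G_r. *)
Definition coeff_sum (R : realType) (D1 D2 : set (dyint R)) (i : nat * nat)
    (f : R * R -> R) (r : dyrect R) : R :=
  \sum_(p \in rdesc D1 D2 r i) `|haar_coeff f p|.

(** * Finiteness of the sums and size of the shift *)

Section Shift.
Context {R : realType} {D1 D2 : set (dyint R)}.
Context (g1 : dyadic_grid D1) (g2 : dyadic_grid D2).
Implicit Types (f g : R * R -> R) (i j : nat * nat) (r p q : dyrect R).

Lemma area_gt0 r : 0 < area r.
Proof. by rewrite mulr_gt0// ilen_gt0. Qed.

Lemma finite_rdesc r i : (D1 `*` D2) r -> finite_set (rdesc D1 D2 r i).
Proof. by move=> [r1 r2]; apply: finite_setX; exact: finite_idesc. Qed.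

Lemma coeff_sum_ge0 i f r : 0 <= coeff_sum D1 D2 i f r.
Proof. by rewrite /coeff_sum; apply: fsumr_ge0. Qed.

Lemma coeff_sum_neq0 i f r p : (D1 `*` D2) r -> rdesc D1 D2 r i p ->
  haar_coeff f p != 0 -> coeff_sum D1 D2 i f r != 0.
Proof.
move=> Dr rp fp; rewrite /coeff_sum fsbig_finite/=; last exact: finite_rdesc.
rewrite (big_rem p)/=; last by rewrite in_fset_set ?inE//; exact: finite_rdesc.
by rewrite gt_eqF// ltr_wpDr ?normr_gt0// sumr_ge0.
Qed.

(** A nonzero sum at [r] needs a descendant [p] with nonzero coefficient. There are finitely many
    such [p], and each has at most one ancestor [r] of the given order. *)
Lemma finite_coeff_sum i f : test_function D1 D2 f ->
  finite_set [set r | (D1 `*` D2) r /\ coeff_sum D1 D2 i f r != 0].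
Proof.
move=> tf; have fin := finite_haar_support g1 g2 tf.
apply: (@sub_finite_set _ _ (\bigcup_(p in [set p | (D1 `*` D2) p /\ haar_coeff f p != 0])
    [set r | (D1 `*` D2) r /\ rdesc D1 D2 r i p])); last first.
  apply: bigcup_finite => // p _.
  have [[r [[r1 r2] [rp1 rp2]]]|no] := pselect (exists r, (D1 `*` D2) r /\ rdesc D1 D2 r i p).
    apply: (@sub_finite_set _ _ [set r]) => // -[s1 s2] [[/= Ds1 Ds2] [/= sp1 sp2]].
    rewrite /= (idesc_ancestor g1 Ds1 r1 sp1 rp1) (idesc_ancestor g2 Ds2 r2 sp2 rp2).
    by case: (r).
  apply: (@sub_finite_set _ _ set0) => // r rp; case: no; by exists r.
move=> r [Dr]; rewrite /coeff_sum fsbig_finite/=; last exact: finite_rdesc.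
have [[p [rp fp]] _|no] := pselect (exists p, rdesc D1 D2 r i p /\ haar_coeff f p != 0).
  by exists p => //; split => //; case: rp => [[? _ _] [? _ _]].
rewrite big_seq big1 ?eqxx// => p.
rewrite in_fset_set ?inE; last exact: finite_rdesc.
move=> rp; apply/eqP; rewrite normr_eq0; apply: contra_notT no => fp.
by exists p.
Qed.

Lemma rset_desc r j q : rdesc D1 D2 r j q -> rset q `<=` rset r.
Proof. by move=> [[_ h1 _] [_ h2 _]] y [y1 y2]; split; [exact: h1|exact: h2]. Qed.

Lemma area_desc r j q : rdesc D1 D2 r j q -> area q = 2 ^- (j.1 + j.2) * area r.
Proof. by move=> [[_ _ l1] [_ _ l2]]; rewrite /area l1 l2 exprD invfM mulrACA. Qed.

(** The descendants of order [j] tile [r] with equal areas, so at each point of [r] exactly one term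
    survives. Hence the second index of a shifted square function affects it only through a constant
    factor. *)
Lemma sum_desc_indic r j (y : R * R) : (D1 `*` D2) r ->
  \sum_(q \in rdesc D1 D2 r j)
     (\1_(iset q.1) y.1 / ilen q.1) * (\1_(iset q.2) y.2 / ilen q.2) =
  2 ^+ (j.1 + j.2) / area r * \1_(rset r) y.
Proof.
move=> Dr.
have termE q : rdesc D1 D2 r j q ->
    (\1_(iset q.1) y.1 / ilen q.1) * (\1_(iset q.2) y.2 / ilen q.2) =
    2 ^+ (j.1 + j.2) / area r * \1_(rset q) y.
  move=> rq; rewrite mulrACA -invfM -/(area q) (area_desc rq) invfM invrK mulrC.
  congr (_ * _); rewrite !indicE -natrM mulnb; congr ((nat_of_bool _)%:R).
  apply/esym; apply/idP/idP; rewrite inE.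
    by move=> [h1 h2]; rewrite !mem_set.
  by move/andP; rewrite !inE => -[].
rewrite (eq_fsbigr (fun q => 2 ^+ (j.1 + j.2) / area r * \1_(rset q) y)); last first.
  by move=> q; rewrite inE; exact: termE.
rewrite fsbig_finite/=; last exact: finite_rdesc.
have memE q : (q \in finmap.enum_fset (fset_set (rdesc D1 D2 r j))) = (q \in rdesc D1 D2 r j).
  by rewrite in_fset_set//; exact: finite_rdesc.
have [[y1 y2]|ry] := pselect (rset r y).
  have [q1 rq1 yq1] := idesc_cover g1 j.1 Dr.1 y1.
  have [q2 rq2 yq2] := idesc_cover g2 j.2 Dr.2 y2.
  rewrite (bigD1_seq (q1, q2)) ?finmap.fset_uniq//=; last by rewrite memE mem_set.
  rewrite [\1_(rset r) y]indicE mem_set// [\1_(rset (q1, q2)) y]indicE mem_set//.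
  rewrite big_seq_cond big1 ?addr0// => q /andP[]; rewrite memE inE => -[rq1' rq2'] qq.
  rewrite indicE memNset ?mulr0// => -[qy1 qy2]; case/eqP: qq.
  rewrite [q]surjective_pairing.
  by rewrite (idesc_uniq g1 rq1' rq1 qy1 yq1) (idesc_uniq g2 rq2' rq2 qy2 yq2).
rewrite [\1_(rset r) y]indicE memNset// mulr0 big_seq big1// => q; rewrite memE inE.
by move=> rq; rewrite indicE memNset ?mulr0// => /(rset_desc rq).
Qed.

(** The list [l] may exceed the support of the sums, since extra rectangles contribute 0; this lets
    [f] and [g] share one list. *)
Lemma shifted_squareE i j f (l : seq (dyrect R)) (y : R * R) :
  uniq l -> (forall r, r \in l -> (D1 `*` D2) r) ->
  (forall r, (D1 `*` D2) r -> coeff_sum D1 D2 i f r != 0 -> r \in l) ->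
  shifted_square D1 D2 i j f y =
  (Num.sqrt (2 ^+ (j.1 + j.2)) * square_sum rset area l (coeff_sum D1 D2 i f) y)%:E.
Proof.
move=> ul lD lP; rewrite /shifted_square /square_sum -sqrtrM ?exprn_ge0//.
rewrite (_ : esum _ _ = (2 ^+ (j.1 + j.2) *
  \sum_(r <- l) coeff_sum D1 D2 i f r ^+ 2 / area r * \1_(rset r) y)%:E)//.
transitivity (\esum_(r in [set` l])
    (coeff_sum D1 D2 i f r ^+ 2 * (2 ^+ (j.1 + j.2) / area r * \1_(rset r) y))%:E)%E.
  rewrite esum_mkcond [RHS]esum_mkcond; apply: eq_esum => r _.
  have [rl|rl] := boolP (r \in l).
    rewrite [r \in [set` l]]mem_set// mem_set; last exact: lD.
    by rewrite sum_desc_indic//; exact: lD.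
  rewrite [r \in [set` l]]memNset; last exact/negP.
  have [Dr|Dr] := pselect ((D1 `*` D2) r); last by rewrite memNset.
  rewrite mem_set// -/(coeff_sum D1 D2 i f r).
  have [->|/(lP _ Dr)] := eqVneq (coeff_sum D1 D2 i f r) 0; last by rewrite (negbTE rl).
  by rewrite expr0n mul0r.
rewrite esum_fset; last 2 first.
- exact: finite_seq.
- move=> r _; rewrite lee_fin mulr_ge0 ?sqr_ge0// mulr_ge0// divr_ge0 ?exprn_ge0//.
  exact: ltW (area_gt0 r).
rewrite -fsbig_seq// sumEFin big_distrr/=; congr (_%:E); apply: eq_bigr => r _.
ring.
Qed.

(** By linearity the pairing is a finite sum of coefficients of [f] times coefficients of [g]. After
    the triangle inequality the bound on [a] depends only on the complexity, so the sums over [p]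
    and [q] factor. *)
Lemma shift_pairing_le i j a f g (l : seq (dyrect R)) :
  shift_coeffs D1 D2 i j a -> test_function D1 D2 f -> test_function D1 D2 g ->
  uniq l -> (forall r, r \in l -> (D1 `*` D2) r) ->
  (forall r, (D1 `*` D2) r -> coeff_sum D1 D2 i f r != 0 -> r \in l) ->
  `|pairing (dyadic_shift D1 D2 i j a f) g| <=
  (Num.sqrt (2 ^+ (i.1 + i.2)) * Num.sqrt (2 ^+ (j.1 + j.2)))^-1 *
  \sum_(r <- l) coeff_sum D1 D2 i f r * coeff_sum D1 D2 j g r.
Proof.
move=> ha tf tg ul lD lP.
pose P r := finmap.enum_fset (fset_set (rdesc D1 D2 r i)).
pose Q r := finmap.enum_fset (fset_set (rdesc D1 D2 r j)).
have PE r p : (D1 `*` D2) r -> p \in P r -> rdesc D1 D2 r i p.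
  by move=> Dr; rewrite in_fset_set ?inE//; exact: finite_rdesc.
have QE r q : (D1 `*` D2) r -> q \in Q r -> rdesc D1 D2 r j q.
  by move=> Dr; rewrite in_fset_set ?inE//; exact: finite_rdesc.
have TE : dyadic_shift D1 D2 i j a f = fun y => \sum_(r <- l) \sum_(p <- P r)
    \sum_(q <- Q r) a p q r * haar_coeff f p * haar q y.
  apply/funext => y; rewrite /dyadic_shift.
  (* Outside [l] every descendant of order [i] has zero coefficient, so the sum over all rectangles
     is a genuinely finite one. *)
  rewrite -(fsbig_widen [set` l] (D1 `*` D2)); last 2 first.
  - by move=> r /= /lD.
  - move=> r [Dr rl] /=; rewrite fsbig1// => p rp.
    have fp : haar_coeff f p = 0.
      apply/eqP; apply: contra_notT rl => fp.
      by apply: lP => //; exact: coeff_sum_neq0 fp.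
    by rewrite fsbig1// => q _; rewrite fp mulr0 mul0r.
  rewrite -fsbig_seq// big_seq [RHS]big_seq; apply: eq_bigr => r /lD Dr.
  rewrite fsbig_finite/=; last exact: finite_rdesc.
  by apply: eq_bigr => p _; rewrite fsbig_finite//; exact: finite_rdesc.
have pq q : pairable (haar q) g by exact: pairable_haar tg.
rewrite TE pairing_suml; last first.
  move=> r; apply: pairable_suml => p; apply: pairable_suml => q.
  exact: pairableZl.
rewrite big_distrr/=; apply: le_trans (ler_norm_sum _ _ _) _.
rewrite big_seq [X in _ <= X]big_seq; apply: ler_sum => r /lD Dr.
rewrite pairing_suml; last first.
  by move=> p; apply: pairable_suml => q; exact: pairableZl.
rewrite /coeff_sum !fsbig_finite/=; try exact: finite_rdesc.
rewrite big_distrl/= big_distrr/=; apply: le_trans (ler_norm_sum _ _ _) _.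
rewrite big_seq [X in _ <= X]big_seq; apply: ler_sum => p /(PE _ _ Dr) rp.
rewrite pairing_suml; last by move=> q; exact: pairableZl.
rewrite !big_distrr/=; apply: le_trans (ler_norm_sum _ _ _) _.
rewrite big_seq [X in _ <= X]big_seq; apply: ler_sum => q /(QE _ _ Dr) rq.
rewrite pairingZl// /haar_coeff [pairing g (haar q)]pairingC !normrM -!mulrA.
apply: ler_wpM2r; first by rewrite mulr_ge0.
apply: le_trans (ha _ _ _ Dr rp rq) _.
rewrite -sqrtrM ?mulr_ge0 ?(ltW (ilen_gt0 _))//.
(* Both areas are fixed fractions of [area r], so the area of [r] cancels from the normalisation and
   only the powers of 2 remain. *)
rewrite mulrACA -/(area p) -/(area q) -/(area r) (area_desc rp) (area_desc rq).
rewrite mulrACA -invfM -expr2 sqrtrM ?invr_ge0 ?mulr_ge0 ?exprn_ge0//.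
have A0 := area_gt0 r.
rewrite sqrtr_sqr gtr0_norm// mulfK ?gt_eqF// sqrtrV ?mulr_ge0 ?exprn_ge0//.
by rewrite sqrtrM ?exprn_ge0.
Qed.

End Shift.

(** * Averages of shifted square functions and the conclusion *)

Section Averages.
Context {R : realType} {D1 D2 : set (dyint R)}.
Context (g1 : dyadic_grid D1) (g2 : dyadic_grid D2).

Lemma average_shifted_square i j f (l : seq (dyrect R)) (r : dyrect R) :
  uniq l -> (forall r, r \in l -> (D1 `*` D2) r) ->
  (forall r, (D1 `*` D2) r -> coeff_sum D1 D2 i f r != 0 -> r \in l) ->
  average (shifted_square D1 D2 i j f) r =
  (Num.sqrt (2 ^+ (j.1 + j.2)) * square_average (@leb2 R) rset area l
     (coeff_sum D1 D2 i f) r)%:E.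
Proof.
move=> ul lD lP; rewrite /average.
have H := @integralZl _ _ R (@leb2 R) (rset r) (measurable_rset r) _
  (@integrable_square_sum _ _ R (@leb2 R) _ (@rset R) area l
     (@measurable_rset R) (@area_gt0 R) (@leb2_rset R)
     (coeff_sum D1 D2 i f) r) (Num.sqrt (2 ^+ (j.1 + j.2))).
have H2 := @square_averageE _ _ R (@leb2 R) _ (@rset R) area l
     (@measurable_rset R) (@area_gt0 R) (@leb2_rset R)
     (coeff_sum D1 D2 i f) r.
under eq_integral do rewrite (shifted_squareE g1 g2 j _ ul lD lP) EFinM.
rewrite [X in (_ * X)%E]H [X in (_ * (_ * X))%E]H2 -!EFinM; congr (_%:E).
by rewrite mulrCA mulKf// gt_eqF// area_gt0.
Qed.

End Averages.

Theorem theorem2 (R : realType) :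
  exists C eta : R, [/\ 0 < C, 0 < eta, eta < 1 &
    forall (D1 D2 : set (dyint R)) (i j : nat * nat)
           (a : dyrect R -> dyrect R -> dyrect R -> R) (f g : R * R -> R),
      dyadic_grid D1 -> dyadic_grid D2 ->
      shift_coeffs D1 D2 i j a ->
      test_function D1 D2 f -> test_function D1 D2 g ->
      exists S : set (dyrect R),
        [/\ S `<=` D1 `*` D2, sparse eta S &
            ((`|pairing (dyadic_shift D1 D2 i j a f) g|)%:E <=
             (C * 2 ^- (i.1 + i.2 + j.1 + j.2)%N)%:E *
             \esum_(r in S) ((area r)%:E *
                             average (shifted_square D1 D2 i j f) r *
                             average (shifted_square D1 D2 j i g) r))%E]].
Proof.
exists 256, 2^-1; split=> //; first by rewrite invf_lt1// ltr1n.
move=> D1 D2 i j a f g g1 g2 ha tf tg.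
pose N := coeff_sum D1 D2.
have finl : finite_set ([set r | (D1 `*` D2) r /\ N i f r != 0] `|`
    [set r | (D1 `*` D2) r /\ N j g r != 0]).
  by rewrite finite_setU; split; exact: finite_coeff_sum.
pose l := finmap.enum_fset (fset_set ([set r | (D1 `*` D2) r /\ N i f r != 0] `|`
    [set r | (D1 `*` D2) r /\ N j g r != 0])).
have ul : uniq l by exact: finmap.fset_uniq.
have lE r : (r \in l) = (r \in ([set r | (D1 `*` D2) r /\ N i f r != 0] `|`
    [set r | (D1 `*` D2) r /\ N j g r != 0])) by rewrite in_fset_set.
have lD r : r \in l -> (D1 `*` D2) r by rewrite lE inE => -[[]|[]].
have lf r : (D1 `*` D2) r -> N i f r != 0 -> r \in l.
  by move=> Dr fr; rewrite lE inE; left.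
have lg r : (D1 `*` D2) r -> N j g r != 0 -> r \in l.
  by move=> Dr gr; rewrite lE inE; right.
have [S [E [uS Sl hE tE dom]]] :=
  @sparse_square_domination _ _ R (@leb2 R) _ (@rset R) area l (@measurable_rset R)
  (@area_gt0 R) (@leb2_rset R) _ _ (@coeff_sum_ge0 R D1 D2 i f) (@coeff_sum_ge0 R D1 D2 j g).
exists [set` S]; split.
- by move=> r /= /Sl /lD.
- by exists E; split.
pose U r := square_average (@leb2 R) rset area l (N i f) r.
pose V r := square_average (@leb2 R) rset area l (N j g) r.
(* The averages of [shifted_square] for ([i], [j], [f]) and ([j], [i], [g]) are [cj] and [ci] times
   those of the plain square sums. The sparse sum thus gains [ci * cj], while the pairing estimate
   carries its inverse; the mismatch is [(ci * cj) ^- 2], exactly the power of 2 in the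
   statement. *)
pose ci : R := Num.sqrt (2 ^+ (i.1 + i.2)).
pose cj : R := Num.sqrt (2 ^+ (j.1 + j.2)).
have ci0 : 0 < ci by rewrite sqrtr_gt0 exprn_gt0.
have cj0 : 0 < cj by rewrite sqrtr_gt0 exprn_gt0.
have EE : (\esum_(r in [set` S]) ((area r)%:E *
    average (shifted_square D1 D2 i j f) r * average (shifted_square D1 D2 j i g) r) =
    (ci * cj * \sum_(r <- S) area r * U r * V r)%:E)%E.
  rewrite esum_fset; last 2 first.
  - exact: finite_seq.
  - move=> r; rewrite inE /= => /Sl rl.
    rewrite (average_shifted_square g1 g2 j r ul lD lf).
    rewrite (average_shifted_square g1 g2 i r ul lD lg) -!EFinM lee_fin.
    have sa0 k h : 0 <= square_average (@leb2 R) rset area l (N k h) r.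
      rewrite mulr_ge0 ?invr_ge0 ?(ltW (area_gt0 r))//.
      by apply: Rintegral_ge0 => x _; exact: sqrtr_ge0.
    apply: mulr_ge0; [apply: mulr_ge0; first exact: ltW (area_gt0 r)|].
      by apply: mulr_ge0; [exact: sqrtr_ge0 | exact: sa0].
    by apply: mulr_ge0; [exact: sqrtr_ge0 | exact: sa0].
  rewrite -fsbig_seq// big_distrr/= -sumEFin; apply: eq_bigr => r _.
  rewrite (average_shifted_square g1 g2 j r ul lD lf).
  rewrite (average_shifted_square g1 g2 i r ul lD lg) -!EFinM; congr (_%:E).
  rewrite -/(U r) -/(V r) -/ci -/cj; ring.
rewrite EE -EFinM lee_fin.
apply: le_trans (shift_pairing_le g1 g2 ha tf tg ul lD lf) _.
have -> : 2 ^- (i.1 + i.2 + j.1 + j.2) = (ci * cj)^-1 * (ci * cj)^-1 :> R.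
  rewrite -invfM mulrACA -!expr2 !sqr_sqrtr ?exprn_ge0// -exprD.
  by rewrite addnA.
rewrite (_ : 256 * _ * _ = (ci * cj)^-1 * (256 * \sum_(r <- S) area r * U r * V r)).
  by rewrite ler_pM2l// invr_gt0 mulr_gt0.
field; by rewrite !gt_eqF.
Qed.
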